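(* Let $\mathcal{H}$ be a complex Hilbert space, let $n$ be a positive integer, let $S_1,\dots,S_n\in\mathcal{B}(\mathcal{H})$, let $q\in(0,1]$, and let $\sigma=e^{\pi \mathrm{i}/n}$ and $\omega=e^{2\pi \mathrm{i}/n}$. Let $\mathbb{S}_{scirc}$ be the skew circulant operator matrix $$\mathbb{S}_{scirc}=\begin{bmatrix} S_1 & S_2 & S_3 & \cdots & S_n\\ -S_n & S_1 & S_2 & \cdots & S_{n-1}\\ -S_{n-1} & -S_n & S_1 & \ddots & S_{n-2}\\ \vdots & \vdots & \ddots & \ddots & \vdots\\ -S_2 & -S_3 & \cdots & -S_n & S_1\end{bmatrix}$$ acting on $\bigoplus_{j=1}^n\mathcal{H}$. Then $$\max_{0\le k\le n-1} w_q\left(\sum_{j=1}^n(\sigma\omega^k)^{1-j}S_j\right)\le w_q(\mathbb{S}_{scirc})\le \frac{q+2\sqrt{1-q^2}}{q}\max_{0\le k\le n-1} w_q\left(\sum_{j=1}^n(\sigma\omega^k)^{1-j}S_j\right).$$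
   Context: $\mathcal{B}(\mathcal{K})$ denotes the bounded linear operators on a complex Hilbert space $\mathcal{K}$. An $n\times n$ matrix $[S_{ij}]$ with entries in $\mathcal{B}(\mathcal{H})$ acts on $\bigoplus_{j=1}^n\mathcal{H}$ (with the direct-sum inner product) by $(x_1,\dots,x_n)\mapsto(\sum_j S_{1j}x_j,\dots,\sum_j S_{nj}x_j)$. For $A\in\mathcal{B}(\mathcal{K})$ and a scalar $q$ with $|q|\le 1$, the $q$-numerical range is $W_q(A)=\{\langle Ax,y\rangle: x,y\in\mathcal{K},\ \|x\|=\|y\|=1,\ \langle x,y\rangle=q\}$ and the $q$-numerical radius is $w_q(A)=\sup\{|z|: z\in W_q(A)\}$. In the degenerate case $\dim\mathcal{K}=1$, where $A$ is a scalar $c$ and $W_q(A)$ is empty for $0<q<1$, the convention is $w_q(A)=q|c|$. *)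

(* Defs.v *)
From HB Require Import structures.
From mathcomp Require Import all_boot all_order all_algebra sesquilinear.
From mathcomp Require Import all_classical all_reals all_analysis.
From mathcomp.real_closed Require Import complex.
Set Implicit Arguments.
Unset Strict Implicit.
Unset Printing Implicit Defensive.
Import Order.TTheory GRing.Theory Num.Theory.
Import numFieldNormedType.Exports.
Local Open Scope classical_set_scope.
Local Open Scope ring_scope.
Local Open Scope complex_scope.

(* The inner product is linear in its first argument and conjugate-linear in
   the second one. *)
HB.mixin Record isHilbert (R : realType) (H : Type)
    of CompleteNormedModule R[i] H := {
  hdot : {dot H for (@Num.conj R[i])} ;
  hdot_norm : forall x : H, hdot x x = `|x| ^+ 2
}.

#[short(type="hilbertType")]
HB.structure Definition Hilbert (R : realType) :=
  {H of isHilbert R H & CompleteNormedModule R[i] H}.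

Section direct_sum.
Variables (R : realType) (H : hilbertType R) (n : nat).
Local Notation K := {ffun 'I_n -> H}.

Definition dsdot (x y : K) : R[i] := \sum_(i < n) hdot (x i) (y i).

Lemma dsdot_bilinear :
  bilinear_for ( *%R : GRing.Scale.law _ _)
    ((@Num.conj R[i]) \; *%R : GRing.Scale.law _ _) dsdot.
Proof.
split=> [y a x x'|x a y y'] /=; rewrite /dsdot mulr_sumr -big_split /=;
  apply: eq_bigr => i _.
- by rewrite !ffunE linearDl linearZl_LR.
- by rewrite !ffunE linearDr linearZr_LR.
Qed.

HB.instance Definition _ :=
  bilinear_isBilinear.Build R[i] K K R[i] _ _ dsdot dsdot_bilinear.

Lemma dsdot_hermitian (x y : K) :
  dsdot x y = (-1) ^+ false * Num.conj (dsdot y x).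
Proof.
rewrite expr0 mul1r /dsdot rmorph_sum; apply: eq_bigr => i _ /=.
by rewrite (hermitian_subproof (x i) (y i)) expr0 mul1r.
Qed.

HB.instance Definition _ :=
  isHermitianSesquilinear.Build R[i] K false (@Num.conj R[i]) dsdot
    dsdot_hermitian.

Lemma dsdot_gt0 (x : K) : x != 0 -> 0 < dsdot x x.
Proof.
move=> x0; rewrite lt_def sumr_ge0 ?andbT => [|i _]; last by rewrite dnorm_ge0.
apply: contraNneq x0 => /eqP; rewrite psumr_eq0 => [/allP h|i _].
  apply/eqP/ffunP => i; rewrite ffunE; apply/eqP.
  by rewrite -(dnorm_eq0 hdot); apply: (h i); rewrite mem_index_enum.
by rewrite dnorm_ge0.
Qed.

HB.instance Definition _ := isDotProduct.Build R[i] K dsdot dsdot_gt0.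

End direct_sum.

Section q_numerical_radius.
Variables (R : realType) (K : lmodType R[i]) (f : {dot K for (@Num.conj R[i])}).

Definition dotnorm (x : K) : R[i] := sqrtC (f x x).

Definition q_num_range (q : R[i]) (A : K -> K) : set R[i] :=
  [set z | exists x y : K,
    [/\ dotnorm x = 1, dotnorm y = 1, f x y = q & z = f (A x) y]].

Definition one_dim : Prop :=
  exists2 e : K, e != 0 & forall x, exists a : R[i], x = a *: e.

(* In dimension one A is multiplication by a unique scalar c, found here by
   [xget].  Otherwise, for a bounded A the supremum is over a bounded set; this
   set is empty only on the zero space, where the library convention
   [sup set0 = 0] applies. *)
Definition q_num_radius (q : R) (A : K -> K) : R :=
  if `[< one_dim >] && (0 < q < 1)
  then q * Normc.normc (xget 0 [set c | forall x, A x = c *: x])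
  else sup [set Normc.normc z | z in q_num_range q%:C A].

End q_numerical_radius.

Section skew_circulant.
Variables (R : realType) (H : lmodType R[i]) (n : nat).

Definition opmx_act (M : 'I_n -> 'I_n -> H -> H)
    (x : {ffun 'I_n -> H}) : {ffun 'I_n -> H} :=
  [ffun i => \sum_(j < n) M i j (x j)].

Definition cyclic_sub (j i : 'I_n) : 'I_n :=
  Ordinal (ltn_pmod (n + j - i) (leq_trans (ltn0Sn i) (ltn_ord i))).

(* The operators S_1, ..., S_n are indexed from 0, so that S_(j+1) is [S j]. *)
Definition skew_circulant (S : 'I_n -> H -> H) (i j : 'I_n) (x : H) : H :=
  if (i <= j)%N then S (cyclic_sub j i) x else - S (cyclic_sub j i) x.

Definition expi (t : R) : R[i] := cos t +i* sin t.

Definition sigma : R[i] := expi (pi / n%:R).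
Definition omega : R[i] := expi (2 * pi / n%:R).

(* With the indexing from 0 above, the exponent 1 - j becomes - j. *)
Definition skew_dft (S : 'I_n -> H -> H) (k : nat) (x : H) : H :=
  \sum_(j < n) (sigma * omega ^+ k) ^- j *: S j x.

End skew_circulant.

(* Main.v *)
From HB Require Import structures.
Require Import Defs.
From mathcomp Require Import all_boot all_order all_algebra sesquilinear spectral.
From mathcomp Require Import all_classical all_reals all_analysis.
From mathcomp.real_closed Require Import complex.
From mathcomp Require Import ring lra.
Set Implicit Arguments.
Unset Strict Implicit.
Unset Printing Implicit Defensive.
Import Order.TTheory GRing.Theory Num.Theory.
Import numFieldNormedType.Exports.
Local Open Scope classical_set_scope.
Local Open Scope ring_scope.

(** Write A for the skew circulant operator matrix and T_k for the operator
    sum_j z_k^(-j) S_(j+1), where z_k = sigma omega^k runs over the n-th roots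
    of -1.

    Since z_k^n = -1, the sign changes below the diagonal are exactly what
    makes E_k v := n^(-1/2) (z_k^(-j) v)_j satisfy A E_k = E_k T_k
    ([skew_circulant_row_embed]).  The z_k are pairwise distinct, so the scalar
    matrix with entries n^(-1/2) z_k^(-j) is unitary ([skew_dft_unitary]): the
    E_k are isometries with pairwise orthogonal ranges that span the direct sum,
    and A is unitarily equivalent to diag(T_0, ..., T_(n-1)).

    Lower bound.  The isometry E_k carries a pair (x, y) admissible for T_k to a
    pair admissible for A that yields the same number, whence
    w_q(T_k) <= w_q(A) ([q_num_radius_intertwine]).

    Upper bound.  Let w denote the ordinary numerical radius.
    - q w(T) <= w_q(T): for a unit vector v and a unit vector z orthogonal to
      it, y = q v + s z and y' = q v - s z with s = sqrt(1 - q^2) are both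
      admissible with v, and <Tv, y> + <Tv, y'> = 2 q <Tv, v>
      ([q_quad_form_le]).
    - w_q(A) <= (q + 2 s) w(A): if <x, y> = q then y = q x + s z with z a unit
      vector orthogonal to x, so <Ax, y> = q <Ax, x> + s <Ax, z>, and
      |<Ax, z>| <= 2 w(A) by polarization ([q_num_radius_le]).
    - w(A) = max_k w(T_k), because <AX, X> is the sum of the
      <T_k c_k, c_k> over the components c_k of X ([dsdot_block_diag]).
    With m = max_k w_q(T_k) this gives w(A) <= m / q, and then
    w_q(A) <= (q + 2 s) m / q.

    In dimension one, where there is no unit vector orthogonal to a given one,
    the convention w_q(c) = q |c| makes the first two inequalities hold as
    well; the first one, applied to A at a vector E_k v, then also yields the
    lower bound. *)

(** * Sesquilinear estimates *)

Section DotProduct.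
Variables (C : numClosedFieldType) (K : lmodType C) (f : {dot K for (@Num.conj C)}).
Implicit Types (x y : K) (a : C).

Lemma dotDl x x' y : f (x + x') y = f x y + f x' y.
Proof. exact: linearDl. Qed.

Lemma dotDr x y y' : f x (y + y') = f x y + f x y'.
Proof. exact: linearDr. Qed.

Lemma dotZl a x y : f (a *: x) y = a * f x y.
Proof. exact: linearZl_LR. Qed.

Lemma dotZr a x y : f x (a *: y) = Num.conj a * f x y.
Proof. exact: linearZr_LR. Qed.

Lemma dotC x y : f x y = Num.conj (f y x).
Proof. by rewrite hermC expr0 mul1r. Qed.

Let conjCN1 : Num.conj (-1) = -1 :> C.
Proof. by rewrite rmorphN rmorph1. Qed.

Let conjCNi : Num.conj (- 'i) = 'i :> C.
Proof. by rewrite rmorphN /= conjCi opprK. Qed.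

Variable A : {linear K -> K}.

Lemma quad_formDZ x y a :
  f (A (x + a *: y)) (x + a *: y) =
  f (A x) x + Num.conj a * f (A x) y + a * f (A y) x
    + a * Num.conj a * f (A y) y.
Proof.
rewrite (linearD A) (linearZ_LR A) !dotDl !dotDr !dotZl !dotZr.
by ring.
Qed.

Lemma polarization x y :
  4 * f (A x) y =
  f (A (x + y)) (x + y) - f (A (x - y)) (x - y)
  + 'i * f (A (x + 'i *: y)) (x + 'i *: y)
  - 'i * f (A (x - 'i *: y)) (x - 'i *: y).
Proof.
have i2 : 'i * 'i = -1 :> C by rewrite -expr2 sqrCi.
rewrite -{2 3}(scale1r y) -(scaleN1r y) -(scaleNr 'i y).
rewrite !quad_formDZ ?conjCN1 ?conjCNi conjC1 conjCi.
by ring: i2.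
Qed.

Lemma parallelogram x y :
  f (x + y) (x + y) + f (x - y) (x - y) = 2 * (f x x + f y y).
Proof. by rewrite hnormD hnormB /=; ring. Qed.

(** The norm of an operator is at most twice its numerical radius: bound each
    term of [polarization] and add up the squared norms with [parallelogram].
    For the identity and M = 1 it is a weak Cauchy-Schwarz inequality, strong
    enough to derive bounds on the form from bounds on norms. *)
Lemma le_dot_of_quad_form (M : C) :
  (forall v, `|f (A v) v| <= M * f v v) ->
  forall x y, `|f (A x) y| <= M * (f x x + f y y).
Proof.
move=> AM x y.
rewrite -(@ler_pM2l _ 4)// -[X in X * `|_|]normr_nat -normrM polarization.
have -> : 4 * (M * (f x x + f y y)) = M * f (x + y) (x + y)
   + M * f (x - y) (x - y) + M * f (x + 'i *: y) (x + 'i *: y)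
   + M * f (x - 'i *: y) (x - 'i *: y).
  rewrite -mulrDr parallelogram -addrA -mulrDr parallelogram.
  by rewrite dnormZ normCi expr1n; ring.
apply: le_trans (ler_normD _ _) (lerD (le_trans (ler_normD _ _)
  (lerD (le_trans (ler_normD _ _) (lerD _ _)) _)) _).
all: rewrite ?normrN ?normrM ?normCi ?mul1r; exact: AM.
Qed.

Lemma dot_normalize x : x != 0 ->
  f ((sqrtC (f x x))^-1 *: x) ((sqrtC (f x x))^-1 *: x) = 1.
Proof.
move=> x0; rewrite dnormZ normfV ger0_norm ?sqrt_dnorm_ge0// exprVn sqrtCK.
by rewrite mulVf ?dnorm_eq0.
Qed.

End DotProduct.

(** * The q-numerical radius and the quadratic form *)

Section QNumericalRadius.
Local Open Scope complex_scope.
Variables (R : realType) (K : lmodType R[i]) (f : {dot K for (@Num.conj R[i])}).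
Variables (q : R) (A : {linear K -> K}).
Hypotheses (q_gt0 : 0 < q) (q_le1 : q <= 1).
Local Notation s := (Num.sqrt (1 - q ^+ 2)).

(** Boundedness is expressed through the form, as this is what bounds the
    q-numerical range, and it makes sense in any inner product space. *)
Definition form_bounded : Prop := exists M : R, forall x y,
  f x x = 1 -> f y y = 1 -> `|f (A x) y| <= M%:C.

Lemma normcR_le (z : R[i]) (r : R) : (Normc.normc z <= r) = (`|z| <= r%:C).
Proof. by rewrite -lecR. Qed.

Lemma conjCR (r : R) : Num.conj (r%:C : R[i]) = r%:C.
Proof. exact: conjc_real. Qed.

Lemma dotnorm1P (x : K) : dotnorm f x = 1 <-> f x x = 1.
Proof.
rewrite /dotnorm; split => [h|->]; last exact: sqrtC1.
by rewrite -[LHS]sqrtCK h expr1n.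
Qed.

Lemma sqr_add_compl : q%:C ^+ 2 + s%:C ^+ 2 = 1 :> R[i].
Proof.
rewrite -!rmorphXn -rmorphD /= sqr_sqrtr ?subrKC//.
by rewrite subr_ge0 expr_le1// ltW.
Qed.

Lemma one_dim_scalar : one_dim K -> exists c, forall x, A x = c *: x.
Proof.
case=> e e0 span; have [c Ae] := span (A e); exists c => x.
by have [b ->] := span x; rewrite linearZ/= Ae !scalerA mulrC.
Qed.

Lemma q_num_radius_one_dim : one_dim K -> q < 1 ->
  exists2 c, forall x, A x = c *: x & q_num_radius f q A = q * Normc.normc c.
Proof.
move=> K1 q1; set c := xget 0 [set c | forall x, A x = c *: x].
exists c; first exact: (xgetPex 0 (one_dim_scalar K1)).
by rewrite /q_num_radius q_gt0 q1 andbT asboolT.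
Qed.

Lemma q_num_radius_sup : ~ (one_dim K /\ q < 1) ->
  q_num_radius f q A = sup [set Normc.normc z | z in q_num_range f q%:C A].
Proof.
move=> h; rewrite /q_num_radius q_gt0 /=; case: ifPn => // /andP[/asboolP k1 q1].
by case: h.
Qed.

(** Equality in the Cauchy-Schwarz inequality: in dimension one the
    q-numerical range is empty for q < 1. *)
Lemma one_dim_dot x y : one_dim K -> f x x = 1 -> f y y = 1 -> `|f x y| = 1.
Proof.
case=> e _ span; have [a ->] := span x; have [b ->] := span y.
rewrite !dnormZ dotZl dotZr !normrM norm_conjC => xx yy.
apply/eqP; rewrite -sqrp_eq1 ?mulr_ge0//; apply/eqP.
rewrite !exprMn [`|f e e|]ger0_norm ?dnorm_ge0//.
by rewrite -[RHS]mul1r -{1}xx -yy; ring.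
Qed.

(** This covers the case where [q_num_radius] is not a supremum: in dimension
    one with q < 1, there is no admissible pair. *)
Lemma le_q_num_radius x y : form_bounded ->
  f x x = 1 -> f y y = 1 -> f x y = q%:C ->
  `|f (A x) y| <= (q_num_radius f q A)%:C.
Proof.
move=> [M AM] xx yy xy; rewrite -normcR_le q_num_radius_sup; last first.
  move=> [K1 q1]; have := one_dim_dot K1 xx yy.
  rewrite xy ger0_norm ?ler0c ?ltW// => /complexI q1'.
  by rewrite q1' ltxx in q1.
apply: ub_le_sup.
  exists M => _ [_ [u [v [/dotnorm1P uu /dotnorm1P vv _ ->]]] <-].
  by rewrite normcR_le; exact: AM.
by exists (f (A x) y) => //; exists x, y; split => //; exact/dotnorm1P.
Qed.

Lemma normc_ge0 (z : R[i]) : 0 <= Normc.normc z.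
Proof. by rewrite -ler0c; exact: (normr_ge0 z). Qed.

Lemma q_num_radius_ge0 : 0 <= q_num_radius f q A.
Proof.
have [[K1 q1]|h] := pselect (one_dim K /\ q < 1).
  have [c _ ->] := q_num_radius_one_dim K1 q1.
  by rewrite mulr_ge0 ?normc_ge0// ltW.
rewrite q_num_radius_sup//; set E := (X in sup X).
have [[[_ [z Wz _]] ubE]|noE] := pselect (has_sup E); last by rewrite sup_out.
by apply: le_trans (normc_ge0 z) (ub_le_sup ubE _); exists z.
Qed.

Lemma exists_unit_orthogonal v : f v v = 1 -> ~ one_dim K ->
  exists2 z, f z z = 1 & f v z = 0.
Proof.
move=> vv Kn1.
have [x xv] : exists x, forall a, x <> a *: v.
  apply: contrapT => h; apply: Kn1; exists v.
    by rewrite -(dnorm_eq0 f) vv oner_eq0.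
  move=> x; apply: contrapT => hx; apply: h; exists x => a xa.
  by apply: hx; exists a.
(* The component orthogonal to v of a vector that is no multiple of v. *)
pose z := x - f x v *: v.
have z0 : z != 0.
  by apply/eqP => /eqP; rewrite subr_eq0 => /eqP; exact: xv.
have vz : f v z = 0.
  by rewrite linearBr/= dotZr vv mulr1 -dotC subrr.
exists ((sqrtC (f z z))^-1 *: z); first exact: dot_normalize.
by rewrite dotZr vz mulr0.
Qed.

(** In dimension at least two, average the two admissible vectors
    q v + s z and q v - s z, with z orthogonal to v: the unknown term in <Av, z>
    cancels. *)
Lemma q_quad_form_unit v : form_bounded -> f v v = 1 ->
  q%:C * `|f (A v) v| <= (q_num_radius f q A)%:C.
Proof.
move=> Ab vv; have [q1|q1] := eqVneq q 1.
  rewrite {1}q1 mul1r; apply: le_q_num_radius => //.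
  by rewrite vv q1.
have {}q1 : q < 1 by rewrite lt_neqAle q1.
have [K1|Kn1] := pselect (one_dim K).
  have [c Ac ->] := q_num_radius_one_dim K1 q1.
  by rewrite Ac dotZl vv mulr1 rmorphM.
have [z zz vz] := exists_unit_orthogonal vv Kn1.
have zv : f z v = 0 by rewrite dotC vz conjC0.
(* e is one of the signs 1 and -1. *)
have unit_q e : e ^+ 2 = 1 -> Num.conj e = e ->
    `|f (A v) (q%:C *: v + e *: (s%:C *: z))| <= (q_num_radius f q A)%:C.
  move=> e2 ee; apply: le_q_num_radius => //.
    rewrite !dotDl !dotDr !dotZl !dotZr vz zv vv zz ee !conjCR.
    transitivity (q%:C ^+ 2 + e ^+ 2 * s%:C ^+ 2); first by ring.
    by rewrite e2 mul1r sqr_add_compl.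
  by rewrite dotDr !dotZr vv vz conjCR !mulr0 addr0 mulr1.
have -> : q%:C * `|f (A v) v| = `|q%:C * f (A v) v|.
  by rewrite normrM [`|q%:C|]ger0_norm// ler0c ltW.
have := lerD (unit_q 1 (expr1n _ _) (conjC1 _))
  (unit_q (-1) (etrans (sqrrN _) (expr1n _ _)) (etrans (rmorphN _ _) (congr1 _ (conjC1 _)))).
move=> /(le_trans (ler_normD _ _)).
rewrite !dotDr !dotZr !rmorphN conjC1 conjCR => le2.
rewrite -(@ler_pM2l _ 2)// -[X in X * `|_|]normr_nat -normrM.
apply: le_trans (le_trans le2 _); last by rewrite mulrDl mul1r.
by rewrite le_eqVlt; apply/orP; left; apply/eqP; congr (`|_|); ring.
Qed.

Lemma q_quad_form_le v : form_bounded ->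
  q%:C * `|f (A v) v| <= (q_num_radius f q A)%:C * f v v.
Proof.
move=> Ab; have [->|v0] := eqVneq v 0.
  by rewrite !linear0r normr0 !mulr0.
have := q_quad_form_unit Ab (dot_normalize f v0).
rewrite (linearZ_LR A) dotZl dotZr mulrA -normCK normrM normrX normr_id.
rewrite normfV exprVn -normrX sqrtCK (ger0_norm (dnorm_ge0 _ _)) mulrCA.
by rewrite ler_pdivrMl ?dnorm_gt0// [_%:C * f v v]mulrC.
Qed.

(** Split y as q x + r with r orthogonal to x and of norm s; the summand
    <Ax, r> is controlled by [le_dot_of_quad_form]. *)
Lemma q_num_radius_le (M : R) : 0 <= M ->
  (forall v, `|f (A v) v| <= M%:C * f v v) ->
  q_num_radius f q A <= (q + 2 * s) * M.
Proof.
move=> M0 AM; have s0 : 0 <= s := sqrtr_ge0 _.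
have [[K1 q1]|h] := pselect (one_dim K /\ q < 1).
  have [c Ac ->] := q_num_radius_one_dim K1 q1.
  have [e e0 _] := K1.
  have cM : Normc.normc c <= M.
    rewrite normcR_le -(@ler_pM2r _ (f e e)) ?dnorm_gt0//.
    apply: le_trans (AM e).
    by rewrite Ac dotZl normrM [`|f e e|]ger0_norm ?dnorm_ge0.
  rewrite mulrDl; apply: (@le_trans _ _ (q * M)).
    by rewrite ler_pM2l.
  by rewrite lerDl !mulr_ge0.
rewrite q_num_radius_sup//.
have rhs0 : 0 <= (q + 2 * s) * M.
  by rewrite mulr_ge0// addr_ge0 ?mulr_ge0// ltW.
have [->|/set0P ne] := eqVneq [set Normc.normc z | z in q_num_range f q%:C A] set0.
  by rewrite sup0.
apply: ge_sup => // _ [_ [x [y [/dotnorm1P xx /dotnorm1P yy xy ->]]] <-].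
have yx : f y x = q%:C by rewrite dotC xy conjCR.
pose r := y - q%:C *: x.
have rr : f r r = s%:C ^+ 2.
  rewrite linearBl !linearBr /= !dotZl !dotZr conjCR xx yy xy yx.
  by rewrite -[s%:C ^+ 2](addKr (q%:C ^+ 2)) sqr_add_compl; ring.
rewrite normcR_le.
have -> : f (A x) y = q%:C * f (A x) x + f (A x) r.
  by rewrite linearBr /= dotZr conjCR addrC subrK.
have -> : ((q + 2 * s) * M)%:C = q%:C * M%:C + s%:C * (M%:C * (1 + 1)).
  by rewrite !(rmorphM, rmorphD) rmorph1 /=; ring.
apply: (le_trans (ler_normD _ _)); apply: lerD.
  have qC0 : 0 <= q%:C :> R[i] by rewrite ler0c ltW.
  rewrite normrM [`|q%:C|]ger0_norm//; apply: ler_wpM2l => //.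
  by have := AM x; rewrite xx mulr1.
(* For q = 1 the remainder r vanishes; otherwise it is normalized to z. *)
have [s0'|sn0] := eqVneq s 0.
  have -> : r = 0 by apply/eqP; rewrite -(dnorm_eq0 f) rr s0' rmorph0 expr0n.
  by rewrite linear0r normr0 s0' rmorph0 mul0r.
have sC : s%:C != 0 :> R[i] by rewrite -(rmorph0 (real_complex R)) (inj_eq (@complexI R)).
pose z := s%:C^-1 *: r.
have zz : f z z = 1.
  rewrite dnormZ rr normfV exprVn [`|s%:C|]ger0_norm ?ler0c//.
  by rewrite mulVf// expf_neq0.
have -> : r = s%:C *: z by rewrite scalerA mulfV// scale1r.
rewrite dotZr conjCR normrM [`|s%:C|]ger0_norm ?ler0c//.
apply: ler_wpM2l; first by rewrite ler0c.
by have := le_dot_of_quad_form AM x z; rewrite xx zz.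
Qed.

End QNumericalRadius.

(** * Isometries intertwining two operators *)

Section Intertwining.
Local Open Scope complex_scope.
Variables (R : realType) (H K : lmodType R[i]).
Variables (g : {dot H for (@Num.conj R[i])}) (f : {dot K for (@Num.conj R[i])}).
Variables (T : {linear H -> H}) (A : {linear K -> K}) (E : H -> K).
Hypothesis isoE : forall x y, f (E x) (E y) = g x y.
Hypothesis AE : forall x, A (E x) = E (T x).

Lemma form_bounded_intertwine : form_bounded f A -> form_bounded g T.
Proof.
by case=> M AM; exists M => x y xx yy; rewrite -isoE -AE AM ?isoE.
Qed.

(** Admissible pairs are carried over by E.  If H has dimension one and q < 1
    there are none, but then T is a scalar c, E maps H to eigenvectors of A,
    and [q_quad_form_le] at an eigenvector gives q |c| <= w_q(A), even
    when K has a larger dimension. *)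
Lemma q_num_radius_intertwine (q : R) : 0 < q -> q <= 1 -> form_bounded f A ->
  q_num_radius g q T <= q_num_radius f q A.
Proof.
move=> q0 q1 Ab; have [[H1 qlt1]|h] := pselect (one_dim H /\ q < 1).
  have [c Tc ->] := q_num_radius_one_dim g T q0 H1 qlt1.
  have [e e0 _] := H1.
  have qC0 : 0 <= q%:C :> R[i] by rewrite ler0c ltW.
  have := q_quad_form_le q0 q1 (E e) Ab.
  rewrite AE !isoE Tc dotZl normrM [`|g e e|]ger0_norm ?dnorm_ge0// mulrA.
  by rewrite ler_pM2r ?dnorm_gt0// -lecR rmorphM.
rewrite q_num_radius_sup//.
have [->|/set0P ne] := eqVneq [set Normc.normc z | z in q_num_range g q%:C T] set0.
  by rewrite sup0 q_num_radius_ge0.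
apply: ge_sup => // _ [_ [x [y [/dotnorm1P xx /dotnorm1P yy xy ->]]] <-].
by rewrite normcR_le -isoE -AE; apply: le_q_num_radius; rewrite ?isoE.
Qed.

End Intertwining.

(** * Block diagonalization by a unitary scalar matrix *)

Section UnitaryBlocks.
Variables (R : realType) (H : hilbertType R) (n : nat).
Local Notation K := {ffun 'I_n -> H}.
Variable U : 'M[R[i]]_n.
Hypothesis Uunit : U \is unitarymx.

(** The ranges of the [row_embed k] are the blocks in which A becomes
    diagonal; [row_coef k] is the adjoint of [row_embed k]. *)
Definition row_embed (k : 'I_n) (x : H) : K := [ffun j => U k j *: x].

Definition row_coef (k : 'I_n) (X : K) : H := \sum_j Num.conj (U k j) *: X j.

Lemma unitary_rows k l : \sum_j U k j * Num.conj (U l j) = (k == l)%:R.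
Proof.
have /unitarymxP/matrixP/(_ k l) := Uunit.
by rewrite !mxE => <-; apply: eq_bigr => j _; rewrite !mxE.
Qed.

Lemma unitary_cols i j : \sum_k U k i * Num.conj (U k j) = (i == j)%:R.
Proof.
have /unitarymxP/matrixP/(_ i j) : U^T \is unitarymx by rewrite trmx_unitary.
by rewrite !mxE => <-; apply: eq_bigr => k _; rewrite !mxE.
Qed.

Lemma dsdot_row_embed k l x y :
  dsdot (row_embed k x) (row_embed l y) = (k == l)%:R * hdot x y.
Proof.
rewrite /dsdot -unitary_rows mulr_suml; apply: eq_bigr => j _.
by rewrite !ffunE (dotZl (@hdot R H)) (dotZr (@hdot R H)) mulrA.
Qed.

(** The columns of a square unitary matrix are orthonormal too, so the ranges
    of the [row_embed k] span the whole direct sum. *)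
Lemma row_embed_sum X : X = \sum_k row_embed k (row_coef k X).
Proof.
apply/ffunP => i; rewrite sum_ffunE.
under eq_bigr do rewrite ffunE scaler_sumr.
rewrite exchange_big /= (bigD1 i)//= [X in _ = _ + X]big1 => [|j ji].
  under eq_bigr do rewrite scalerA.
  by rewrite -scaler_suml unitary_cols eqxx scale1r addr0.
under eq_bigr do rewrite scalerA.
by rewrite -scaler_suml unitary_cols eq_sym (negPf ji) scale0r.
Qed.

(** With the identity for A and all T_k, this is the Parseval identity. *)
Lemma dsdot_block_diag (A : {linear K -> K}) (T : 'I_n -> H -> H) :
  (forall k x, A (row_embed k x) = row_embed k (T k x)) ->
  forall X, dsdot (A X) X =
    \sum_k hdot (T k (row_coef k X)) (row_coef k X).
Proof.
move=> AE X; rewrite {1 2}(row_embed_sum X) linear_sum /=.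
pose D := @dsdot R H n.
have Dl Y (F : 'I_n -> K) : D (\sum_k F k) Y = \sum_k D (F k) Y.
  by apply: (big_morph (D^~ Y)) => [a b|]; [exact: linearDl | exact: linear0l].
have Dr Y (F : 'I_n -> K) : D Y (\sum_k F k) = \sum_k D Y (F k).
  by apply: (big_morph (D Y)) => [a b|]; [exact: linearDr | exact: linear0r].
rewrite -/D Dl; apply: eq_bigr => k _; rewrite Dr (bigD1 k)//= big1 => [|l lk].
  by rewrite AE /D dsdot_row_embed eqxx mul1r addr0.
by rewrite AE /D dsdot_row_embed eq_sym (negPf lk) mul0r.
Qed.

End UnitaryBlocks.

(** * The roots of -1 and the skew Fourier matrix *)

Section RootsOfMinusOne.
Local Open Scope complex_scope.
Variable R : realType.

Lemma expiD (a b : R) : expi (a + b) = expi a * expi b.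
Proof.
rewrite /expi cosD sinD; apply/eqP; rewrite eq_complex /= eqxx /=.
by rewrite addrC.
Qed.

Lemma expi0 : expi (0 : R) = 1.
Proof. by rewrite /expi cos0 sin0. Qed.

Lemma expiX (a : R) m : expi a ^+ m = expi (a *+ m).
Proof.
by elim: m => [|m IH]; rewrite ?expr0 ?mulr0n ?expi0// exprS mulrS expiD IH.
Qed.

Lemma norm_expi (a : R) : `|expi a| = 1.
Proof. by rewrite normc_def /= cos2Dsin2 sqrtr1. Qed.

(** The double angle gives cos (2 t) = 1 - 2 sin^2 t, and sin t > 0. *)
Lemma expi_double_neq1 (t : R) : 0 < t < pi -> expi (t *+ 2) != 1.
Proof.
move=> /sin_gt0_pi st; apply/negP => /eqP[].
rewrite cos_mulr2n cos2sin2 => /eqP h _.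
have := exprn_gt0 2 st; lra.
Qed.

Variable n : nat.
Hypothesis n_gt0 : (0 < n)%N.
(** Over k < n these are all the n-th roots of -1. *)
Definition skew_root (k : nat) : R[i] := sigma R n * omega R n ^+ k.
Let n_neq0 : n%:R != 0 :> R. Proof. by rewrite pnatr_eq0 -lt0n. Qed.

Lemma sigmaXn : sigma R n ^+ n = -1.
Proof.
rewrite expiX -(mulr_natr (pi / _)) divfK// /expi cospi sinpi.
by apply/eqP; rewrite eq_complex /= oppr0 !eqxx.
Qed.

Lemma omegaE : omega R n = sigma R n ^+ 2.
Proof. by rewrite expiX /omega -mulrA mulr_natl. Qed.

Lemma norm_skew_root k : `|skew_root k| = 1.
Proof. by rewrite normrM normrX !norm_expi expr1n mulr1. Qed.

Lemma skew_root_neq0 k : skew_root k != 0.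
Proof. by rewrite -normr_eq0 norm_skew_root oner_eq0. Qed.

Lemma skew_rootX k : skew_root k ^+ n = -1.
Proof.
by rewrite exprMn exprAC omegaE (exprAC _ 2) sigmaXn sqrrN !expr1n mulr1.
Qed.

Lemma skew_root_neq (k l : nat) : (k < l < n)%N -> skew_root k != skew_root l.
Proof.
move=> /andP[kl ln]; apply/negP => /eqP e.
have root0 := skew_root_neq0.
have : omega R n ^+ (l - k) = 1.
  by apply: (mulfI (root0 k)); rewrite mulr1 -mulrA -exprD subnKC ?e// ltnW.
rewrite omegaE -exprM mulnC exprM expiX expiX => /eqP; apply/negP.
apply: expi_double_neq1; rewrite pmulrn_lgt0 ?subn_gt0//.
rewrite divr_gt0 ?pi_gt0 ?ltr0n//= -(mulr_natr (pi / _)) mulrAC ltr_pdivrMr ?ltr0n//.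
by rewrite ltr_pM2l ?pi_gt0// ltr_nat (leq_ltn_trans (leq_subr _ _)).
Qed.

Definition skew_dft_mx : 'M[R[i]]_n :=
  \matrix_(k, j) (sqrtC n%:R^-1 * skew_root k ^- j).

(** Two rows have as inner product the geometric sum of z = z_l / z_k, divided
    by n; it vanishes for k <> l since z^n = (-1) / (-1) = 1 while z <> 1. *)
Lemma skew_dft_unitary : skew_dft_mx \is unitarymx.
Proof.
have rtn : sqrtC n%:R^-1 * Num.conj (sqrtC n%:R^-1) = n%:R^-1 :> R[i].
  by rewrite -normCK ger0_norm ?sqrtC_ge0 ?invr_ge0// sqrtCK.
have root0 := skew_root_neq0.
have conj_root l : Num.conj (skew_root l) = (skew_root l)^-1.
  by rewrite invC_norm norm_skew_root expr1n invr1 mul1r.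
apply/unitarymxP/matrixP => k l; rewrite !mxE.
under eq_bigr => j _.
  rewrite !mxE rmorphM /= mulrACA rtn rmorphV ?unitfE ?expf_neq0// rmorphXn /=.
  rewrite conj_root exprVn invrK -exprVn -exprMn.
  over.
rewrite -mulr_sumr; have [->|kl] := eqVneq k l.
  under eq_bigr do rewrite mulVf// expr1n.
  by rewrite sumr_const card_ord mulVf// pnatr_eq0 -lt0n.
have z1 : (skew_root k)^-1 * skew_root l != 1.
  apply/negP => /eqP h; have := congr1 ( *%R (skew_root k)) h.
  rewrite mulVKf// mulr1 => /esym/eqP; apply/negP.
  have [lt|lt|/val_inj e] := ltngtP k l; last by rewrite e eqxx in kl.
    by apply: skew_root_neq; rewrite lt /=.
  by rewrite eq_sym; apply: skew_root_neq; rewrite lt /=.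
have /eqP := subrX1 ((skew_root k)^-1 * skew_root l) n.
rewrite exprMn exprVn !skew_rootX invrN1 mulrNN mulr1 subrr eq_sym mulf_eq0.
by rewrite subr_eq0 (negPf z1) /= => /eqP ->; rewrite mulr0.
Qed.

End RootsOfMinusOne.

(** * Skew circulant operator matrices *)

Section SkewCirculant.
Local Open Scope complex_scope.
Variables (R : realType) (H : hilbertType R) (n : nat).
Variable S : 'I_n -> {linear H -> H}.
Local Notation K := {ffun 'I_n -> H}.
Local Notation Scirc := (opmx_act (skew_circulant (fun j => S j))).

Lemma skew_circulant_act_linear : linear Scirc.
Proof.
move=> a X Y; apply/ffunP => i; rewrite !ffunE scaler_sumr -big_split /=.
apply: eq_bigr => j _; rewrite !ffunE /skew_circulant linearP.
by case: ifP => // _; rewrite opprD scalerN.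
Qed.

HB.instance Definition _ :=
  GRing.isLinear.Build R[i] K K *:%R Scirc skew_circulant_act_linear.

Lemma skew_dft_linear k : linear (skew_dft (fun j => S j) k).
Proof.
move=> a x y; rewrite /skew_dft scaler_sumr -big_split /=.
by apply: eq_bigr => j _; rewrite linearP scalerDr !scalerA mulrC.
Qed.

HB.instance Definition _ k :=
  GRing.isLinear.Build R[i] H H *:%R (skew_dft (fun j => S j) k)
    (skew_dft_linear k).

Lemma cyclic_sub_inj (i : 'I_n) : injective (@cyclic_sub n ^~ i).
Proof.
move=> j j' /(congr1 val) /= /eqP.
rewrite -(eqn_modDr i) !subnK; try exact: leq_trans (ltnW (ltn_ord i)) (leq_addr _ _).
by rewrite !modnDl !modn_small// => /eqP /val_inj.
Qed.

(** In row i the operator in column j is S_l for l = j - i mod n; after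
    reindexing by l, what remains is z^(-j) = z^(-i) z^(-l) when i <= j, and
    - z^(-j) = z^(-i) z^(-l) when j < i, because then i + l = n + j and
    z^n = -1. *)
Lemma skew_circulant_row_embed (n_gt0 : (0 < n)%N) (k : 'I_n) x :
  Scirc (row_embed (skew_dft_mx R n) k x) =
  row_embed (skew_dft_mx R n) k (skew_dft (fun j => S j) k x).
Proof.
apply/ffunP => i; rewrite !ffunE /skew_dft scaler_sumr.
rewrite [RHS](reindex_inj (@cyclic_sub_inj i)) /=; apply: eq_bigr => j _.
rewrite ffunE !mxE /skew_circulant linearZ /= -/(skew_root R n k).
have zn := skew_rootX R n_gt0 k; set z := skew_root R n k in zn *.
rewrite scalerA -mulrA -invfM -exprD.
case: leqP => ij.
  suff -> : ((n + j - i) %% n = j - i)%N by rewrite subnKC.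
  by rewrite -addnBA// modnDl modn_small// (leq_ltn_trans (leq_subr _ _)).
have -> : (i + (n + j - i) %% n = n + j)%N.
  rewrite modn_small ?subnKC//.
    by rewrite (leq_trans (ltnW (ltn_ord i))) ?leq_addr.
  by rewrite ltn_subLR ?(leq_trans (ltnW (ltn_ord i))) ?leq_addr// addnC ltn_add2r.
by rewrite exprD zn mulN1r invrN mulrN scaleNr.
Qed.

Lemma bounded_linear_norm_le (F : {linear H -> H}) : bounded_near F (nbhs (0 : H)) ->
  exists2 C : R[i], 0 <= C & forall x, `|F x| <= C * `|x|.
Proof.
by move=> /linear_boundedP/pinfty_ex_gt0[C C0 FC]; exists C => //; exact: ltW.
Qed.

(** The norm of the i-th component of A X is at most the sum of the bounds of
    the operators in row i. *)
Lemma skew_circulant_bounded :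
  (forall j, bounded_near (S j) (nbhs (0 : H))) ->
  form_bounded (@dsdot R H n) Scirc.
Proof.
move=> Sb; have /choice[C SC] j : exists C : R[i],
    0 <= C /\ forall x, `|S j x| <= C * `|x|.
  by have [C C0 SC] := bounded_linear_norm_le (Sb j); exists C.
(* Sums of squares of the row bounds, plus 1 for the unit vector Y. *)
pose B : R[i] := \sum_(i < n) (\sum_(j < n) C (cyclic_sub j i)) ^+ 2 + 1.
have B0 : 0 <= B.
  apply: addr_ge0 => //; apply: sumr_ge0 => i _.
  by rewrite exprn_ge0// sumr_ge0// => j _; case: (SC (cyclic_sub j i)).
have /complex_realP[b Bb] := ger0_real B0.
exists b => X Y XX YY; rewrite -Bb.
have X1 j : `|X j| <= 1.
  rewrite -(@expr_le1 _ 2)// -XX -hdot_norm /= [leRHS](bigD1 j)//= lerDl.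
  by apply: sumr_ge0 => i _; rewrite dnorm_ge0.
(* |<AX, Y>| <= <AX, AX> + <Y, Y>, from the identity operator. *)
have := @le_dot_of_quad_form _ _ (@dsdot R H n) idfun 1.
rewrite /= => /(_ _ (Scirc X) Y); rewrite mul1r YY => dotle.
apply: (le_trans (dotle _)).
  by move=> V; rewrite mul1r ger0_norm// dnorm_ge0.
rewrite lerD2r; apply: ler_sum => i _; rewrite hdot_norm ffunE.
rewrite lerXn2r ?nnegrE ?sumr_ge0// => [j _|]; first by case: (SC (cyclic_sub j i)).
apply: (le_trans (ler_norm_sum _ _ _)); apply: ler_sum => j _.
have [C0 /(_ (X j)) SX] := SC (cyclic_sub j i).
apply: (@le_trans _ _ `|S (cyclic_sub j i) (X j)|).
  by rewrite /skew_circulant; case: ifP => //; rewrite normrN.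
by apply: (le_trans SX); rewrite ler_piMr.
Qed.

End SkewCirculant.

(** * The two bounds *)

Theorem theorem4p2 (R : realType) (H : hilbertType R) (n : nat)
    (n_gt0 : (0 < n)%N) (S : 'I_n -> {linear H -> H})
    (S_bounded : forall j, bounded_near (S j) (nbhs (0 : H)))
    (q : R) (q_gt0 : 0 < q) (q_le1 : q <= 1) :
  let m := \big[Num.max/0]_(k < n)
    q_num_radius (@hdot R H) q (skew_dft (fun j => S j) k) in
  let w := q_num_radius (@dsdot R H n) q
    (opmx_act (skew_circulant (fun j => S j))) in
  m <= w /\ w <= (q + 2 * Num.sqrt (1 - q ^+ 2)) / q * m.
Proof.
move=> m w.
have Uunit := skew_dft_unitary R n_gt0.
have AE k x := skew_circulant_row_embed S n_gt0 k x.
have Ab := skew_circulant_bounded S_bounded.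
have iso (k : 'I_n) (x y : H) : dsdot (row_embed (skew_dft_mx R n) k x)
    (row_embed (skew_dft_mx R n) k y) = hdot x y.
  by rewrite dsdot_row_embed// eqxx mul1r.
have Tb (k : 'I_n) : form_bounded (@hdot R H) (skew_dft (fun j => S j) k).
  exact: (form_bounded_intertwine (iso k) (AE k) Ab).
split.
  apply: bigmax_le => [|k _]; first exact: q_num_radius_ge0.
  exact: (q_num_radius_intertwine (iso k) (AE k)).
have m0 : 0 <= m by exact: bigmax_ge_id.
rewrite -mulrA (mulrC q^-1).
apply: q_num_radius_le => //; first by rewrite divr_ge0// ltW.
move=> X; have quadA := dsdot_block_diag Uunit AE X.
have quad1 := @dsdot_block_diag _ _ _ _ Uunit idfun (fun=> idfun)
  (fun _ _ => erefl) X.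
rewrite [X in `|X|]quadA [X in _ * X]quad1 mulr_sumr.
apply: (le_trans (ler_norm_sum _ _ _)); apply: ler_sum => k _.
set v := row_coef _ k X.
have := q_quad_form_le q_gt0 q_le1 v (Tb k).
have qC : 0 < q%:C%C :> R[i] by rewrite ltcR.
rewrite -ler_pdivlMl// => /le_trans; apply.
rewrite rmorphM fmorphV mulrA (mulrC m%:C%C); apply: ler_wpM2r; first exact: dnorm_ge0.
apply: ler_wpM2l; first by rewrite invr_ge0 ltW.
rewrite lecR; exact: (le_bigmax _ (fun k : 'I_n =>
  q_num_radius _ q (skew_dft (fun j => S j) k))).
Qed.
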